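(* There is a deterministic $O(\log k)$-competitive algorithm for the online connected facility location problem, where $k$ is the number of clients that arrive online.
   Context: Setting: there is an underlying complete graph $G=(V,E)$ with edge lengths $d(u,v)$ such that $(V,d)$ is a finite metric space whose minimum edge length is $1$. For a graph $H$, $c(H)$ denotes the sum of the lengths of its edges. Online connected facility location problem: at the beginning the algorithm is given a real parameter $M\ge 0$, a set of facilities $F\subseteq V$, a nonnegative opening cost $f_x$ for each $x\in F$, and a designated root facility $r\in F$ with $f_r=0$. Clients (points of $V$) arrive one by one. At any online step the algorithm knows the submetric of $d$ induced on the arrived clients and the facilities. The algorithm maintains a set of open facilities $F'\subseteq F$ and a Steiner tree (connected subgraph) $H$ connecting $F'$ and $r$. When a client $i$ arrives, the algorithm may open a new facility, and then assigns $i$ to some open facility $\sigma(i)\in F'$. All decisions are irrevocable: edges cannot be removed from $H$, clients cannot be reassigned, and opened facilities cannot be closed. The total cost is $\sum_{x\in F'} f_x+Mc(H)+\sum_i d(i,\sigma(i))$ (with the final $F'$ and $H$). Competitiveness: let $\mathrm{OPT}$ be the minimum of this cost over all offline solutions, i.e. all choices of $F'\subseteq F$, $H$ a subgraph of $G$ connecting $F'$ and $r$, and assignments $\sigma$ of the clients to $F'$. A deterministic online algorithm is $O(\log k)$-competitive if there is an absolute constant $c$ such that on every instance with $k\ge 2$ clients its cost is at most $c\cdot\log k\cdot\mathrm{OPT}$. *)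

(* Defs.v *)
From HB Require Import structures.
From mathcomp Require Import all_boot all_order all_algebra.
From mathcomp Require Import reals exp.

Set Implicit Arguments.
Unset Strict Implicit.
Unset Printing Implicit Defensive.

Import Order.TTheory GRing.Theory Num.Theory.
Local Open Scope ring_scope.

(* An instance of connected facility location, together with its client
   sequence.  Several clients may arrive at the same point of V, and a client
   may arrive at a facility. *)
Record instance (R : realType) := MkInstance {
  V : finType;
  d : V -> V -> R;
  d_ge0 : forall u v, 0 <= d u v;
  d_eq0 : forall u v, d u v = 0 <-> u = v;
  d_sym : forall u v, d u v = d v u;
  d_triangle : forall u v w, d u w <= d u v + d v w;
  d_edge_ge1 : forall u v, u != v -> 1 <= d u v;
  (* the minimum is attained as soon as there is an edge at all *)
  d_edge_min : (1 < #|V|)%N -> exists u v, u != v /\ d u v = 1;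
  M : R;
  M_ge0 : 0 <= M;
  F : {set V};
  f : V -> R; (* only the values on F matter *)
  f_ge0 : forall x, x \in F -> 0 <= f x;
  root : V;
  root_F : root \in F;
  f_root : f root = 0;
  k : nat;
  client : 'I_k -> V }.

Arguments d {R} i u v.
Arguments f {R} i x.
Arguments client {R} i j.

(* Subgraphs of the complete graph on T, given by their edges, which are
   two-element subsets of T. *)
Section Subgraph.
Variable T : finType.
Implicit Type H : {set {set T}}.

Definition edge_set H := [forall e in H, #|e| == 2].

Definition adj H : rel T := fun x y => [set x; y] \in H.

Definition joins H (S : {set T}) :=
  [forall x in S, forall y in S, connect (adj H) x y].

(* [cover H] is the set of endpoints of the edges of H. *)
Definition connected_subgraph H (S : {set T}) :=
  edge_set H && joins H (S :|: cover H).

End Subgraph.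

Section Offline.
Variables (R : realType) (I : instance R).

(* The double sum counts each of d u v and d v u once when e = {u, v}; see
   [edge_lengthE]. *)
Definition edge_length (e : {set V I}) : R :=
  (\sum_(u in e) \sum_(v in e) d I u v) / 2%:R.

Definition graph_cost (H : {set {set V I}}) : R := \sum_(e in H) edge_length e.

(* (open facilities F', edges of H, assignment sigma) *)
Definition solution : finType :=
  ({set V I} * {set {set V I}} * {ffun 'I_(k I) -> V I})%type.

Definition cost (s : solution) : R :=
  let: (F', H, sigma) := s in
  \sum_(x in F') f I x + M I * graph_cost H
    + \sum_(i < k I) d I (client I i) (sigma i).

Definition offline_feasible (s : solution) : bool :=
  let: (F', H, sigma) := s in
  [&& F' \subset F I, edge_set H, joins H (root I |: F')
    & [forall i, sigma i \in F']].

Definition root_solution : solution :=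
  ([set root I], set0, [ffun=> root I]).

(* [arg min] requires a feasible default; see [root_solution_feasible]. *)
Definition OPT : R :=
  cost [arg min_(s < root_solution | offline_feasible s) cost s]%O.

Lemma edge_lengthE u v : edge_length [set u; v] = d I u v.
Proof.
have d0 x : d I x x = 0 by apply/d_eq0.
rewrite /edge_length; have [->|uv] := eqVneq u v.
  by rewrite setUid !big_set1 d0 mul0r.
rewrite !big_setU1 ?inE //= !big_set1 !big_setU1 ?inE //= !big_set1.
by rewrite !d0 add0r addr0 (d_sym v u) -mulr2n -[d I u v *+ 2]mulr_natr mulfK // pnatr_eq0.
Qed.

Lemma root_solution_feasible : offline_feasible root_solution.
Proof.
apply/and4P; split.
- by rewrite sub1set root_F.
- by apply/forall_inP => e; rewrite inE.
- apply/forall_inP => x; rewrite !inE orbb => /eqP->.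
  by apply/forall_inP => y; rewrite !inE orbb => /eqP->; exact: connect0.
- by apply/forallP => i; rewrite ffunE inE.
Qed.

Lemma OPT_le s : offline_feasible s -> OPT <= cost s.
Proof.
rewrite /OPT; case: arg_minP; first exact: root_solution_feasible.
by move=> s0 _ min_s0; exact: min_s0.
Qed.

Lemma OPT_attained : exists2 s, offline_feasible s & cost s = OPT.
Proof.
rewrite /OPT; case: arg_minP; first exact: root_solution_feasible.
by move=> s0 ? _; exists s0.
Qed.

End Offline.

(* What an online algorithm knows at some step.  Facilities and arrived clients
   are anonymous labels: inl j is the j-th facility and inr i the i-th client,
   so nothing is known about the other points of V.  Distinct labels may denote
   the same point, in which case their distance is 0. *)
Record view (R : realType) := MkView {
  v_nfac : nat;
  v_narr : nat;
  v_M : R;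
  v_cost : 'I_v_nfac -> R;
  v_root : 'I_v_nfac;
  v_dist : 'I_v_nfac + 'I_v_narr -> 'I_v_nfac + 'I_v_narr -> R }.

(* The answer to the arrival of the latest client: possibly a facility to open,
   edges to add to H, and the facility serving the client.  Decisions only add
   to what is there, which makes them irrevocable. *)
Record decision (R : realType) (w : view R) := MkDecision {
  to_open : option 'I_(v_nfac w);
  to_buy : {set ('I_(v_nfac w) + 'I_(v_narr w)) * ('I_(v_nfac w) + 'I_(v_narr w))};
  to_assign : 'I_(v_nfac w) }.

(* Past decisions need not be an argument: being deterministic, they are
   determined by the restrictions of the current view. *)
Definition algorithm (R : realType) := forall w : view R, decision w.

Section Run.
Variables (R : realType) (A : algorithm R) (I : instance R).

Definition facility (j : 'I_#|F I|) : V I := enum_val j.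

(* Step t : 'I_k is the arrival of client t; clients 0, ..., t are then known. *)
Definition point (t : 'I_(k I)) (p : 'I_#|F I| + 'I_t.+1) : V I :=
  match p with
  | inl j => facility j
  | inr i => client I (widen_ord (ltn_ord t) i)
  end.

Definition view_at (t : 'I_(k I)) : view R :=
  MkView (M I) (fun j => f I (facility j))
    (enum_rank_in (root_F I) (root I))
    (fun p q => d I (@point t p) (@point t q)).

Definition decision_at (t : 'I_(k I)) : decision (view_at t) := A (view_at t).

(* Edges between two labels of the same point are discarded. *)
Definition bought_at (t : 'I_(k I)) : {set {set V I}} :=
  [set [set @point t e.1; @point t e.2]
     | e in to_buy (decision_at t) & @point t e.1 != @point t e.2].

(* F' and H after the first m steps *)
Definition opened (m : nat) : {set V I} :=
  [set x | [exists t : 'I_(k I),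
     (t < m)%N && (omap facility (to_open (decision_at t)) == Some x)]].

Definition bought (m : nat) : {set {set V I}} :=
  \bigcup_(t < k I | (t < m)%N) bought_at t.

Definition assigned (t : 'I_(k I)) : V I := facility (to_assign (decision_at t)).

Definition run_feasible : Prop := forall t : 'I_(k I),
  connected_subgraph (bought t.+1) (root I |: opened t.+1)
  /\ assigned t \in opened t.+1.

Definition run : solution I :=
  (opened (k I), bought (k I), [ffun t => assigned t]).

Definition run_cost : R := cost run.

End Run.

Definition online_algorithm (R : realType) (A : algorithm R) : Prop :=
  forall I : instance R, run_feasible A I.

Definition log_competitive (R : realType) (A : algorithm R) : Prop :=
  exists c : R, forall I : instance R, (2 <= k I)%N ->
    run_cost A I <= c * ln (k I)%:R * OPT I.

(* Main.v *)
(* When client t arrives, its bid b_t is the least cost of connecting it now: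
   open (if necessary) some x, buy one edge from x to an already open y, and
   assign t to x.  The algorithm pays this, unless enough earlier clients near t
   made bids comparable to b_t: then their bids pay for opening and attaching
   some facility very close to t.  The clients that pay for two such openings
   are different, so the total cost is O(sum of the bids).

   No bid exceeds OPT, and the bids below OPT / k add up to at most OPT, so it
   suffices that the n bids in a dyadic range (beta, 2 beta] satisfy
   n beta = O(OPT); there are O(log k) relevant ranges.  A client at distance
   more than beta / 32 from its optimal facility is paid for by its optimal
   assignment cost.  The other ones are grouped by their optimal facility, up to
   a net of these facilities when M >= 1.  The opening rule bounds each group by
   an optimal opening cost plus O(M) (O(1) if M < 1) clients, and the groups
   with a small opening cost are far apart in the metric M d, as well as far from
   the root, so that the optimal tree pays for them. *)
From mathcomp Require Import all_boot all_order all_algebra.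
From mathcomp Require Import reals exp.
From mathcomp Require Import lra zify.
Require Import Defs.

Set Implicit Arguments.
Unset Strict Implicit.
Unset Printing Implicit Defensive.

Import Order.TTheory GRing.Theory Num.Theory.
Local Open Scope ring_scope.

(** * Lower bounds for Steiner trees *)

Section SteinerBound.
Variables (R : realType) (T : finType).
Implicit Types (g : T -> T -> R) (e : {set T}) (H : {set {set T}}) (N : {set T}).

(** The formula of [edge_length] for any [g], so that edges can also be measured by a potential
    difference or a scaled distance. *)
Definition set_length g e : R := (\sum_(u in e) \sum_(v in e) g u v) / 2%:R.

Lemma set_length_ge0 g e : (forall u v, 0 <= g u v) -> 0 <= set_length g e.
Proof. by move=> g0; rewrite divr_ge0 // sumr_ge0 // => u _; rewrite sumr_ge0. Qed.

Lemma set_length_le g g' e :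
  (forall u v, g u v <= g' u v) -> set_length g e <= set_length g' e.
Proof.
by move=> gg'; rewrite ler_wpM2r ?invr_ge0 // ler_sum // => u _; rewrite ler_sum.
Qed.

Lemma set_length2 g u v : (forall a, g a a = 0) -> g u v = g v u -> u != v ->
  set_length g [set u; v] = g u v.
Proof.
move=> g0 guv uv; rewrite /set_length !big_setU1 ?inE //= !big_set1.
rewrite !big_setU1 ?inE //= !big_set1 !g0 -guv; lra.
Qed.

(** The edges of a simple path are distinct, so the telescoping sum counts each once. Summing only
    over edges inside the path lets the induction split off the first edge: it contains [x], which
    the tail avoids. *)
Lemma dist_le_path (phi : T -> R) H x p :
  path (adj H) x p -> uniq (x :: p) ->
  `|phi x - phi (last x p)| <=
    \sum_(e in H | e \subset x :: p) set_length (fun u v => `|phi u - phi v|) e.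
Proof.
elim: p x => [|y p IHp] x /= => [_ _|/andP[xy yp] /andP[xNp uyp]].
  by rewrite subrr normr0 sumr_ge0 // => e _; rewrite set_length_ge0.
have /= IH := IHp y yp uyp.
have xNy : x != y by apply: contraNneq xNp => ->; rewrite mem_head.
rewrite (bigD1 [set x; y]) /=; last first.
  by apply/andP; split=> //; apply/subsetP=> z; rewrite !inE; case/orP=> ->; rewrite ?orbT.
rewrite set_length2 //; [|by move=> a; rewrite subrr normr0|by rewrite distrC].
rewrite (le_trans (ler_distD (phi y) _ _)) // lerD2l (le_trans IH) //.
rewrite [leRHS]big_mkcond [leLHS]big_mkcond ler_sum // => e _.
case: ifP => [/andP[eH esub]|_]; last first.
  by case: ifP => // _; rewrite set_length_ge0.
rewrite eH /=; have -> : e \subset [:: x, y & p].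
  by apply: subset_trans esub _; apply/subsetP => z zyp; rewrite inE zyp orbT.
rewrite ifT //=; apply: contraNneq xNp => e_xy.
by apply: (subsetP esub); rewrite e_xy !inE eqxx.
Qed.

Lemma dist_le_connect (phi : T -> R) H x y : connect (adj H) x y ->
  `|phi x - phi y| <= \sum_(e in H) set_length (fun u v => `|phi u - phi v|) e.
Proof.
case/connectP => p /shortenP[q xq uq _] ->.
apply: le_trans (dist_le_path phi xq uq) _.
by rewrite big_mkcondr ler_sum // => e _; case: ifP; rewrite // set_length_ge0.
Qed.

Variable g : T -> T -> R.
Hypothesis g_ge0 : forall u v, 0 <= g u v.
Hypothesis g_sym : forall u v, g u v = g v u.
Hypothesis g_refl : forall u, g u u = 0.
Hypothesis g_triangle : forall u v w, g u w <= g u v + g v w.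

(** The potential [g^~ y] is 1-Lipschitz for [g] and drops from [g x y] to 0. *)
Lemma dist_le_length H x y : connect (adj H) x y ->
  g x y <= \sum_(e in H) set_length g e.
Proof.
move=> /(dist_le_connect (g^~ y)); rewrite g_refl subr0 ger0_norm // => /le_trans-> //.
apply: ler_sum => e _; apply: set_length_le => u v.
have := g_triangle u v y; have := g_triangle v u y; rewrite (g_sym v u).
by rewrite ler_norml; lra.
Qed.

(** The depth of [v] inside the ball of radius [c] around [n], and 0 outside. *)
Let moat (c : R) n v : R := Num.max (0 : R) (c - g n v).

Lemma moats_disjoint (c : R) n n' v : 2 * c <= g n n' -> 0 < moat c n v -> moat c n' v = 0.
Proof.
move=> sep; rewrite /moat lt_max ltxx /= => pos; apply: max_l.
by have := g_triangle n v n'; rewrite (g_sym v); lra.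
Qed.

Lemma moat_ge0 (c : R) n v : 0 <= moat c n v.
Proof. by rewrite le_max lexx. Qed.

(** Each moat is 1-Lipschitz, and a point has positive depth in at most one. If [u] and [v] lie in
    different balls, around [n] and [m], the depths add up to [2 * c - g n u - g m v], at most
    [g u v] by separation of the centres. *)
Lemma moats_le N (c : R) u v : {in N &, forall n n', n != n' -> 2 * c <= g n n'} ->
  \sum_(n in N) `|moat c n u - moat c n v| <= g u v.
Proof.
move=> sepN.
have lone w n : n \in N -> 0 < moat c n w ->
    {in N, forall m, m != n -> moat c m w = 0}.
  by move=> nN n0 m mN mn; apply: (moats_disjoint (sepN _ _ nN mN _)); rewrite // eq_sym.
have lip n : `|moat c n u - moat c n v| <= g u v.
  have := g_triangle n u v; have := g_triangle n v u; rewrite (g_sym v u).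
  have := g_ge0 u v.
  by rewrite ler_norml /moat; case: (leP 0 (c - g n u)); case: (leP 0 (c - g n v)); lra.
have pos0 w : (forall n, n \in N -> ~~ (0 < moat c n w)) ->
    {in N, forall n, moat c n w = 0}.
  by move=> w0 n /w0; rewrite lt_neqAle moat_ge0 andbT negbK => /eqP.
have [n /andP[nN nu]|/= u0] := pickP [pred n in N | 0 < moat c n u]; last first.
  have {}u0 : {in N, forall n, moat c n u = 0}.
    by apply: pos0 => n nN; have := u0 n; rewrite /= nN /= => ->.
  have [m /andP[mN mv]|/= v0] := pickP [pred n in N | 0 < moat c n v].
    rewrite (bigD1 m) //= big1 ?addr0 // => i /andP[iN im].
    by rewrite (u0 i) // (lone _ _ mN mv i) // subrr normr0.
  rewrite big1 // => n nN; rewrite (u0 n) // (pos0 v) ?subrr ?normr0 // => i iN.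
  by have := v0 i; rewrite /= iN /= => ->.
have [nv|nv] := boolP (0 < moat c n v).
  rewrite (bigD1 n) //= big1 ?addr0 // => i /andP[iN ni].
  by rewrite (lone _ _ nN nu i) // (lone _ _ nN nv i) // subrr normr0.
have {}nv : moat c n v = 0.
  by apply/eqP; rewrite eq_le moat_ge0 andbT leNgt.
rewrite (bigD1 n) //=.
have [m /andP[mN mv]|/= v0] := pickP [pred n in N | 0 < moat c n v]; last first.
  rewrite big1 ?addr0 // => i /andP[iN ni].
  rewrite (lone _ _ nN nu i) // (pos0 v) ?subrr ?normr0 // => j jN.
  by have := v0 j; rewrite /= jN /= => ->.
have mn : m != n by apply: contraTneq mv => ->; rewrite nv ltxx.
rewrite (bigD1 m) /=; last by rewrite mN.
rewrite big1 ?addr0 => [|i /andP[/andP[iN ni] im]]; last first.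
  by rewrite (lone _ _ nN nu i) // (lone _ _ mN mv i) // subrr normr0.
rewrite nv subr0 (lone _ _ nN nu m) // sub0r normrN !ger0_norm ?moat_ge0 //.
move: nu mv; rewrite /moat !lt_max !ltxx /= => nu mv.
rewrite (max_r (ltW nu)) (max_r (ltW mv)).
have := sepN _ _ nN mN; rewrite eq_sym => /(_ mn).
have := g_triangle n u m; have := g_triangle u v m; rewrite (g_sym v m); lra.
Qed.

(* The balls of radius c around the terminals are disjoint, and H crosses each. *)
Lemma steiner_lower_bound N H r (c : R) : 0 <= c ->
  {in N &, forall n n', n != n' -> 2 * c <= g n n'} ->
  {in N, forall n, c <= g n r} -> {in N, forall n, connect (adj H) n r} ->
  #|N|%:R * c <= \sum_(e in H) set_length g e.
Proof.
move=> c0 sepN farN conN.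
apply: le_trans (_ : \sum_(n in N) \sum_(e in H)
  set_length (fun u v => `|moat c n u - moat c n v|) e <= _).
  rewrite -sumr_const mulr_suml ler_sum // => n nN; rewrite mul1r.
  apply: le_trans (dist_le_connect (moat c n) (conN _ nN)).
  rewrite /moat g_refl subr0 (max_r c0) max_l ?subr0 ?ger0_norm //.
  by rewrite subr_le0 farN.
rewrite exchange_big /= ler_sum // => e _; rewrite /set_length.
rewrite -mulr_suml exchange_big /=.
rewrite ler_wpM2r ?invr_ge0 // ler_sum // => u _.
by rewrite exchange_big ler_sum // => v _; apply: moats_le.
Qed.

End SteinerBound.

Lemma card_fibers (T U : finType) (h : T -> U) (A : {set T}) (N : {set U}) :
  {in A, forall t, h t \in N} ->
  #|A| = (\sum_(n in N) #|[set t in A | h t == n]|)%N.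
Proof.
move=> hN; rewrite -sum1_card (partition_big h (mem N)) //=; apply: eq_bigr => n _.
by rewrite -sum1_card; apply: eq_bigl => t; rewrite !inE.
Qed.

(** * Steiner bounds and nets in the metric of an instance *)

Section InstanceFacts.
Variables (R : realType) (I : instance R).
Implicit Types (H : {set {set V I}}) (X N : {set V I}) (u v : V I).

Lemma dist_refl v : d I v v = 0.
Proof. exact/d_eq0. Qed.

Lemma scaled_graph_cost a H :
  \sum_(e in H) set_length (fun u v => a * d I u v) e = a * graph_cost H.
Proof.
rewrite mulr_sumr; apply: eq_bigr => e _; rewrite /edge_length /set_length mulrA.
rewrite mulr_sumr; congr (_ / _); apply: eq_bigr => u _; exact/esym/mulr_sumr.
Qed.

Lemma graph_cost_ge0 H : 0 <= graph_cost H.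
Proof.
by apply: sumr_ge0 => e _; apply: (set_length_ge0 e) => u v; exact: d_ge0.
Qed.

Lemma steiner_cost a N H r c : 0 <= a -> 0 <= c ->
  {in N &, forall n n', n != n' -> 2 * c <= a * d I n n'} ->
  {in N, forall n, c <= a * d I n r} -> {in N, forall n, connect (adj H) n r} ->
  #|N|%:R * c <= a * graph_cost H.
Proof.
move=> a0 c0 sepN farN conN; rewrite -scaled_graph_cost.
apply: steiner_lower_bound farN conN => // [u v|u v|u|u v w].
- by rewrite mulr_ge0 // d_ge0.
- by rewrite d_sym.
- by rewrite dist_refl mulr0.
- by rewrite -mulrDr ler_wpM2l // d_triangle.
Qed.

(** A separated subset of largest cardinality is a net, since an uncovered point could be added. The
    case [n == x] covers nonpositive [r]. *)
Lemma net_exists X r : exists2 N : {set V I}, N \subset X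
  & {in N &, forall n n', n != n' -> r <= d I n n'}
    /\ (forall x, x \in X -> exists2 n, n \in N & (n == x) || (d I x n < r)).
Proof.
pose sep N := (N \subset X) && [forall n in N, forall n' in N, (n != n') ==> (r <= d I n n')].
have sep0 : sep set0.
  by rewrite /sep sub0set /=; apply/forall_inP => n; rewrite inE.
case: (@arg_maxnP _ set0 sep (fun N => #|N|) sep0) => N /andP[NX /forall_inP sepN] maxN.
have {}sepN : {in N &, forall n n', n != n' -> r <= d I n n'}.
  by move=> n n' nN n'N; move/forall_inP: (sepN n nN) => /(_ n' n'N)/implyP.
exists N => //; split=> // x xX.
have [/existsP[n /andP[nN nx]]|noN] := boolP [exists n, (n \in N) && ((n == x) || (d I x n < r))].
  by exists n.
have far n : n \in N -> (n != x) /\ (r <= d I x n).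
  move=> nN; move: noN; rewrite negb_exists => /forallP/(_ n).
  by rewrite nN /= negb_or -leNgt => /andP[].
have xN : x \notin N by apply/negP => /far[]; rewrite eqxx.
suff /maxN : sep (x |: N) by rewrite cardsU1 xN add1n /= ltnn.
rewrite /sep subUset sub1set xX NX; apply/forall_inP => u uN; apply/forall_inP => v vN.
apply/implyP; move: uN vN; rewrite !inE => /predU1P[->|uN] /predU1P[->|vN].
- by rewrite eqxx.
- by case: (far v vN).
- by rewrite (d_sym u); case: (far u uN).
- exact: sepN.
Qed.

End InstanceFacts.

(** * Analysis of runs obeying the opening rule *)

Section OnlineRun.
Variables (R : realType) (I : instance R).
Notation D := (d I).
Notation c := (client I).
Notation step := 'I_(k I).
Implicit Types (s t : step) (p : V I * V I) (Q S : {set step}).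

(* [ch t = (x, y)] means that step t opens x, buys the edge between x and the
   open facility y, and assigns the client to x. *)
Variables (b : step -> R) (ch : step -> V I * V I).

Definition is_open t v := (v == root I) || [exists s : step, (s < t)%N && ((ch s).1 == v)].

Definition eligible t p := (p.1 \in F I) && is_open t p.2.

Definition option_cost t p :=
  (if is_open t p.1 then 0 else f I p.1) + M I * D p.1 p.2 + D (c t) p.1.

Definition witnesses t : {set step} :=
  [set s : step | [&& (s <= t)%N, b t / 2 <= b s <= 2 * b t & D (c s) (c t) <= b t / 8]].

(** Each witness bids at least [b t / 2], so the cost allowed here is at most four times the sum of
    the witness bids. *)
Definition triggers t p := [&& eligible t p, D (c t) p.1 <= b t / 16
  & f I p.1 + M I * D p.1 p.2 <= 2 * #|witnesses t|%:R * b t].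

(** The analysis uses only these four properties; which triggering pair is taken is left open. *)
Hypothesis ch_eligible : forall t, eligible t (ch t).
Hypothesis bid_le : forall t p, eligible t p -> b t <= option_cost t p.
Hypothesis bid_attained : forall t, exists2 p, eligible t p & b t = option_cost t p.
Hypothesis ch_rule : forall t, triggers t (ch t) \/
  option_cost t (ch t) = b t /\ forall p, ~~ triggers t p.

Lemma root_open t : is_open t (root I).
Proof. by rewrite /is_open eqxx. Qed.

Lemma earlier_open s t : (s < t)%N -> is_open t (ch s).1.
Proof. by move=> st; apply/orP; right; apply/existsP; exists s; rewrite st eqxx. Qed.

Lemma open_F t v : is_open t v -> v \in F I.
Proof.
case/predU1P => [->|/existsP[s /andP[_ /eqP<-]]]; first exact: root_F.
by case/andP: (ch_eligible s).
Qed.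

Lemma bid_le_open t v : is_open t v -> b t <= D (c t) v.
Proof.
move=> ov; have /bid_le : eligible t (v, v) by rewrite /eligible /= ov (open_F ov).
by rewrite /option_cost /= ov dist_refl mulr0 !add0r.
Qed.

Lemma opening_ge0 t x : x \in F I -> 0 <= (if is_open t x then 0 else f I x).
Proof. by move=> xF; case: ifP => // _; apply: f_ge0. Qed.

Lemma option_cost_ge0 t p : p.1 \in F I -> 0 <= option_cost t p.
Proof.
move=> pF; have := opening_ge0 t pF; have := d_ge0 (c t) p.1.
have := mulr_ge0 (M_ge0 I) (d_ge0 p.1 p.2); rewrite /option_cost; lra.
Qed.

Lemma option_cost_le t p : p.1 \in F I ->
  option_cost t p <= f I p.1 + M I * D p.1 p.2 + D (c t) p.1.
Proof. by move=> pF; rewrite /option_cost; have := f_ge0 pF; case: ifP; lra. Qed.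

Lemma bid_ge0 t : 0 <= b t.
Proof. by have [p /andP[pF _] ->] := bid_attained t; apply: option_cost_ge0. Qed.

Lemma bid_le_through t x y : x \in F I -> is_open t y ->
  b t <= f I x + M I * D x y + D (c t) x.
Proof.
move=> xF oy; have /bid_le/le_trans-> // : eligible t (x, y) by rewrite /eligible /= xF oy.
exact: option_cost_le.
Qed.

(** Take [y] from a pair [(x, y)] attaining the bid and split [M I * D (c t) y] at [x]: one part is
    [M I] times the assignment cost, the other is the edge cost. *)
Lemma bid_near t : exists2 y, is_open t y & M I * D (c t) y <= Num.max 1 (M I) * b t.
Proof.
have [[x y] /andP[/= xF oy] ->] := bid_attained t; exists y => //.
rewrite /option_cost /=; have := opening_ge0 t xF; set o := (if _ then _ else _) => o0.
set m := Num.max _ _; have m1 : 1 <= m by rewrite le_max lexx.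
have mM : M I <= m by rewrite le_max lexx orbT.
have := ler_wpM2l (M_ge0 I) (d_triangle (c t) x y).
have := mulr_ge0 (M_ge0 I) (d_ge0 x y).
have := d_ge0 (c t) x; have := M_ge0 I; nra.
Qed.

Lemma self_witness t : t \in witnesses t.
Proof.
rewrite inE leqnn dist_refl; have := bid_ge0 t => b0.
by apply/and3P; split=> //; [apply/andP; split|]; lra.
Qed.

Lemma witness_bid s t : s \in witnesses t -> b t <= 2 * b s.
Proof. by rewrite inE => /and3P[_ /andP[h _] _]; lra. Qed.

(** Through [c s] and [c t], the facility opened at [t] is within [b t' / 8 + b t / 8 + b t / 16] of
    [c t']. As [b t <= 2 * b s <= 4 * b t'], this is at most 7/8 of [b t'], contradicting
    [bid_le_open]. *)
Lemma witness_unique s t t' : 0 < b s -> s \in witnesses t -> s \in witnesses t' ->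
  triggers t (ch t) -> (t < t')%N -> False.
Proof.
rewrite !inE => bs /and3P[_ /andP[? ?] ?] /and3P[_ /andP[? ?] ?] /and3P[_ ? _].
move=> /earlier_open/bid_le_open.
have := d_triangle (c t') (c s) (ch t).1; have := d_triangle (c s) (c t) (ch t).1.
rewrite (d_sym (c t') (c s)); lra.
Qed.

Lemma sum_triggered : \sum_(t | triggers t (ch t)) #|witnesses t|%:R * b t <= 2 * \sum_t b t.
Proof.
apply: le_trans (_ : \sum_(t | triggers t (ch t)) \sum_(s in witnesses t) 2 * b s <= _).
  apply: ler_sum => t _; rewrite -sumr_const mulr_suml ler_sum // => s sW.
  by rewrite mul1r witness_bid.
rewrite (exchange_big_dep predT) //= mulr_sumr ler_sum // => s _.
have [bs|] := ltP 0 (b s); last first.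
  move=> bs; have -> : b s = 0 by apply/eqP; rewrite eq_le bs bid_ge0.
  by rewrite mulr0 big1.
have [t /andP[tT sW]|none] := pickP [pred t | triggers t (ch t) & s \in witnesses t].
  rewrite (bigD1 t) ?tT //= big1 ?addr0 // => t' /andP[/andP[t'T sW'] tt'].
  case: (ltngtP t t') => [lt|lt|/val_inj e].
  - by case: (witness_unique bs sW sW' tT lt).
  - by case: (witness_unique bs sW' sW t'T lt).
  - by rewrite e eqxx in tt'.
by rewrite big_pred0 // mulr_ge0 // ltW.
Qed.

Lemma sum_option_cost : \sum_t option_cost t (ch t) <= 6 * \sum_t b t.
Proof.
(* A triggered step costs at most [2 * #|witnesses t|%:R * b t + b t / 16], any other step [b t].
   The witness terms add up to at most [4 * \sum_t b t]. *)
apply: le_trans (_ : 2 * (\sum_(t | triggers t (ch t)) #|witnesses t|%:R * b t)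
   + 2 * \sum_t b t <= _); last by have := sum_triggered; lra.
rewrite [X in 2 * X + _]big_mkcond !mulr_sumr -big_split /= ler_sum // => t _.
have b0 := bid_ge0 t.
case: ifP => [/and3P[/andP[xF _] h1 h2]|nT].
  by have := option_cost_le t xF; lra.
by case: (ch_rule t) => [|[-> _]]; [rewrite nT|lra].
Qed.

(** * Bids in one dyadic range against a fixed offline solution *)

Section Scale.
Variables (Fs : {set V I}) (H : {set {set V I}}) (sg : step -> V I) (beta : R).
Hypothesis Fs_F : Fs \subset F I.
Hypothesis sg_Fs : forall t, sg t \in Fs.
Hypothesis H_joins : forall x, x \in Fs -> connect (adj H) x (root I).
Hypothesis beta_gt0 : 0 < beta.

Let in_scale t := beta < b t <= 2 * beta.
Let near t := D (c t) (sg t) <= beta / 32.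
Let m := Num.max 1 (M I).

Lemma f_ge0_Fs x : x \in Fs -> 0 <= f I x.
Proof. by move=> xFs; apply/f_ge0/(subsetP Fs_F). Qed.

Lemma sg_F t : sg t \in F I.
Proof. exact: (subsetP Fs_F). Qed.

(* A step whose bid is at least beta cannot follow a nearby triggered step, so
   at most the last step of Q is triggered, and the last but one sees all the
   previous ones as witnesses. *)
Lemma cluster_bound Q : (0 < #|Q|)%N ->
  {in Q, forall t, in_scale t} -> {in Q, forall t, near t} ->
  {in Q &, forall s t, D (c s) (c t) <= beta / 8} ->
  exists2 t, t \in Q & #|Q|%:R * beta <= f I (sg t) + 4 * m * beta.
Proof.
move=> /card_gt0P[t0 t0Q] Qscale Qnear Qclose; have b0 := beta_gt0.
have m1 : 1 <= m by rewrite le_max lexx.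
have mM : M I <= m by rewrite le_max lexx orbT.
have mb : beta <= m * beta by rewrite ler_peMl // ltW.
case: (@arg_maxnP _ t0 (fun t => t \in Q) (fun t => t) t0Q) => l lQ lmax.
have [/eqP Ql|/set0Pn[t1 t1Q]] := boolP (Q :\ l == set0).
  exists l => //; rewrite (cardsD1 l) lQ Ql cards0 mul1r.
  by have := f_ge0_Fs (sg_Fs l); lra.
case: (@arg_maxnP _ t1 (fun t => t \in Q :\ l) (fun t => t) t1Q) => t /setD1P[tl tQ] tmax.
exists t => //.
have tl' : (t < l)%N by rewrite ltn_neqAle (inj_eq val_inj) tl; apply: lmax.
have /andP[bt1 bt2] := Qscale _ tQ; have /andP[bl1 bl2] := Qscale _ lQ.
(* A facility opened by a trigger at [t] would be within [beta / 8 + b t / 16 <= beta / 4] of [c l],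
   and [l] would bid too little. *)
have nT : forall p, ~~ triggers t p.
  case: (ch_rule t) => [/and3P[_ xt _]|[]//].
  have := bid_le_open (earlier_open tl'); have := Qclose _ _ lQ tQ.
  have := d_triangle (c l) (c t) (ch t).1; lra.
(* The pair [(sg t, y)] can fail only the cost test, so opening and attaching [sg t] exceeds
   [2 * #|witnesses t|%:R * b t]; its edge costs at most [m * (beta / 32) + 2 * m * beta]. *)
have [y oy yb] := bid_near t; rewrite -/m in yb.
have := nT (sg t, y); rewrite /triggers /eligible /= sg_F oy /=.
have nt := Qnear _ tQ; rewrite /near in nt.
have -> /= : D (c t) (sg t) <= b t / 16 by lra.
rewrite -ltNge => fW.
have QW : #|Q|.-1%:R <= #|witnesses t|%:R :> R.
  rewrite ler_nat (cardsD1 l) lQ add1n /= subset_leq_card //.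
  apply/subsetP => s sQ; have st : (s <= t)%N := tmax _ sQ; case/setD1P: sQ => sl sQ.
  have /andP[bs1 bs2] := Qscale _ sQ; have := Qclose _ _ sQ tQ => Dst.
  by rewrite inE st /=; apply/andP; split; [apply/andP; split|]; lra.
have Q1 : (#|Q|)%:R = 1 + (#|Q|.-1)%:R :> R.
  by rewrite (cardsD1 l) lQ add1n /= -natr1 addrC.
rewrite Q1.
have := ler_pM (ler0n _ _) (ltW b0) QW (ltW bt1).
have := ler_wpM2l (M_ge0 I) (d_triangle (sg t) (c t) y).
have : M I * D (sg t) (c t) <= m * (beta / 32).
  by apply: ler_pM mM _; rewrite ?M_ge0 ?d_ge0 // d_sym.
have : m * b t <= m * (2 * beta) by rewrite ler_wpM2l // (le_trans _ m1).
have : 0 <= (#|Q|.-1)%:R * beta by rewrite mulr_ge0 ?ler0n ?ltW.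
lra.
Qed.

Lemma far_bound : #|[set t | in_scale t && ~~ near t]|%:R * beta
  <= 32 * \sum_t D (c t) (sg t).
Proof.
rewrite -sumr_const mulr_suml mulr_sumr big_mkcond ler_sum // => t _.
have := d_ge0 (c t) (sg t); rewrite inE; case: ifP => [/andP[_]|_]; last by lra.
by rewrite /near -ltNge; lra.
Qed.

Let near_scale := [set t | in_scale t && near t].

Lemma near_scaleP t : reflect (in_scale t /\ near t) (t \in near_scale).
Proof. by rewrite inE; apply: andP. Qed.

(** Clients sharing a net point are within [4 * (beta / 32)] of each other, as [cluster_bound]
    requires. The term [4 * M I * beta] per net point is 256 times its share [M I * (beta / 64)] of
    the tree. *)
Lemma near_bound_large_M : 1 <= M I -> #|near_scale|%:R * beta
  <= \sum_(x in Fs) f I x + 256 * (M I * graph_cost H).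
Proof.
move=> M1; have b0 := beta_gt0; have mE : m = M I by apply/max_r.
pose X := [set sg t | t in near_scale].
have [N NX [sepN netN]] := net_exists X (beta / 32).
pose rep x := odflt x [pick n in N | (n == x) || (D x n < beta / 32)].
have repP x : x \in X -> rep x \in N /\ D x (rep x) <= beta / 32.
  move=> xX; rewrite /rep; case: pickP => [n /andP[nN]|/= no] /=.
    by case/predU1P => [<-|/ltW//]; rewrite dist_refl; split=> //; lra.
  by have [n nN nx] := netN x xX; have := no n; rewrite nN nx.
(* The root is far from the net: a client near its optimal facility bids more than [beta], yet could
   be assigned to the root. *)
have steiner : #|N|%:R * (beta / 64) <= graph_cost H.
  rewrite -[leRHS]mul1r; apply: (@steiner_cost _ _ _ _ _ (root I)) => //.
  - lra.
  - by move=> n n' nN n'N nn'; rewrite mul1r; apply: le_trans (sepN _ _ nN n'N nn'); lra.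
  - move=> n /(subsetP NX)/imsetP[t /near_scaleP[/andP[bt _]]]; rewrite /near => nt ->.
    have := bid_le_open (root_open t); have := d_triangle (c t) (sg t) (root I); lra.
  - by move=> n /(subsetP NX)/imsetP[t _ ->]; apply: H_joins.
pose Q n := [set t in near_scale | rep (sg t) == n].
have QE : \sum_(n in N) #|Q n|%:R = #|near_scale|%:R :> R.
  rewrite -natr_sum; congr _%:R; apply/esym/(@card_fibers _ _ (rep \o sg)) => t tS.
  by case: (repP (sg t)); first exact: imset_f.
(* Each opening cost is counted under a single net point; the index condition is shaped for
   [partition_big]. *)
have Qb n : n \in N -> #|Q n|%:R * beta <=
    \sum_(x in Fs | (rep x \in N) && (rep x == n)) f I x + 4 * M I * beta.
  move=> nN; have sum0 (P : pred (V I)) : 0 <= \sum_(x in Fs | P x) f I x.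
    by apply: sumr_ge0 => x /andP[/f_ge0_Fs].
  have [Q0|] := posnP #|Q n|.
    by rewrite Q0 mul0r addr_ge0 ?sum0 // !mulr_ge0 ?M_ge0 // ltW.
  case/cluster_bound => [t|t|s t|t].
  - by rewrite inE => /andP[/near_scaleP[]].
  - by rewrite inE => /andP[/near_scaleP[]].
  - rewrite !inE => /andP[/andP[ss ns] /eqP rs] /andP[/andP[tt nt] /eqP rt].
    have [_] := repP _ (imset_f sg (introT (near_scaleP s) (conj ss ns))).
    have [_] := repP _ (imset_f sg (introT (near_scaleP t) (conj tt nt))).
    rewrite rs rt; move: ns nt; rewrite /near.
    have := d_triangle (c s) (sg s) (c t); have := d_triangle (sg s) n (c t).
    have := d_triangle n (sg t) (c t); rewrite (d_sym n (sg t)) (d_sym (sg t) (c t)); lra.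
  - rewrite inE => /andP[tS /eqP rt] /le_trans-> //; rewrite mE lerD2r.
    rewrite (bigD1 (sg t)) /=; last by rewrite sg_Fs rt nN eqxx.
    rewrite lerDl; apply: sumr_ge0 => x; case/andP=> /andP[xFs _] _; exact: f_ge0_Fs.
apply: le_trans (_ : \sum_(n in N) (\sum_(x in Fs | (rep x \in N) && (rep x == n)) f I x
    + 4 * M I * beta) <= _).
  by rewrite -QE mulr_suml ler_sum.
rewrite big_split /= sumr_const lerD //.
  under eq_bigr do under eq_bigl do rewrite andbA.
  rewrite -(partition_big rep (mem N)) /=; last by move=> x /andP[].
  rewrite [leRHS]big_mkcond [leLHS]big_mkcond ler_sum // => x _.
  case: ifP => [/andP[-> _]//|_]; case: ifP => // ; exact: f_ge0_Fs.
rewrite -mulr_natl; have := ler_wpM2l (M_ge0 I) steiner; lra.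
Qed.

(** If the optimal facility costs more than [beta / 4], the additive [4 * beta] of [cluster_bound]
    is at most 16 opening costs. A cheaper facility serves at most one near client of this range. *)
Lemma near_bound_small_M : M I <= 1 -> #|near_scale|%:R * beta
  <= 17 * \sum_(x in Fs) f I x + 4 * (M I * graph_cost H).
Proof.
move=> M1; have b0 := beta_gt0; have mE : m = 1 by apply/max_l.
have M0 := M_ge0 I.
pose cheap := [set t in near_scale | f I (sg t) <= beta / 4].
have cheapP t : t \in cheap -> [/\ beta < b t <= 2 * beta, D (c t) (sg t) <= beta / 32
    & f I (sg t) <= beta / 4].
  by rewrite inE => /andP[/near_scaleP[]].
have costly_bound : #|near_scale :\: cheap|%:R * beta <= 17 * \sum_(x in Fs) f I x.
  pose Q x := [set t in near_scale :\: cheap | sg t == x].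
  have -> : #|near_scale :\: cheap|%:R = \sum_(x in Fs) #|Q x|%:R :> R.
    by rewrite -natr_sum; congr _%:R; apply: card_fibers => t _; apply: sg_Fs.
  rewrite mulr_suml mulr_sumr ler_sum // => x xFs.
  have [Q0|] := posnP #|Q x|; first by rewrite Q0 mul0r mulr_ge0 ?f_ge0_Fs.
  have QP t : t \in Q x -> [/\ in_scale t, near t, beta / 4 < f I x & sg t = x].
    by rewrite !inE => /andP[/andP[h /andP[ts tn]] /eqP tx]; move: h; rewrite ts tn tx -ltNge.
  case/cluster_bound => [t /QP[]|t /QP[]|s t|t] //.
    move=> /QP[_ + _ sx] /QP[_ + _ tx]; rewrite /near sx tx.
    have := d_triangle (c s) x (c t); rewrite (d_sym x); lra.
  by move=> /QP[_ _ fx ->]; rewrite mE; lra.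
(* The client's own bid suffices as witness: opening and attaching [sg t] costs at most
   [beta / 4 + beta / 32 + b t]. *)
have cheap_triggers t : t \in cheap -> triggers t (ch t).
  case/cheapP=> /andP[bt1 bt2] nt ft; case: (ch_rule t) => [//|[_ nT]].
  have [y oy yb] := bid_near t; rewrite -/m mE in yb.
  have := nT (sg t, y); rewrite /triggers /eligible /= sg_F oy /=.
  have -> /= : D (c t) (sg t) <= b t / 16 by lra.
  rewrite -ltNge => fW; exfalso.
  have W1 : 1 <= #|witnesses t|%:R :> R.
    by rewrite ler1n; apply/card_gt0P; exists t; apply: self_witness.
  have Wb : b t <= #|witnesses t|%:R * b t by rewrite ler_peMl ?bid_ge0.
  have := ler_wpM2l M0 (d_triangle (sg t) (c t) y); rewrite (d_sym (sg t) (c t)).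
  have : M I * D (c t) (sg t) <= D (c t) (sg t) by rewrite ler_piMl ?d_ge0.
  lra.
(* The trigger at [s] opened a facility within [b s / 16] of [c s]. Opening [sg t] and attaching it
   there must cost [t] more than [beta], and all but the stretch from [sg s] to [sg t] is small. *)
have sep s t : s \in cheap -> t \in cheap -> (s < t)%N -> beta / 2 <= M I * D (sg s) (sg t).
  move=> sC tC st; have /and3P[_ xs _] := cheap_triggers s sC.
  have [/andP[bs1 bs2] ns _] := cheapP _ sC; have [/andP[bt1 bt2] nt ft] := cheapP _ tC.
  have := bid_le_through (sg_F t) (earlier_open st).
  have := ler_wpM2l M0 (d_triangle (sg t) (sg s) (ch s).1).
  have := ler_wpM2l M0 (d_triangle (sg s) (c s) (ch s).1).
  rewrite (d_sym (sg s) (c s)) (d_sym (sg t) (sg s)).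
  have : M I * D (c s) (sg s) <= D (c s) (sg s) by rewrite ler_piMl ?d_ge0.
  have : M I * D (c s) (ch s).1 <= D (c s) (ch s).1 by rewrite ler_piMl ?d_ge0.
  lra.
have sep2 s t : s \in cheap -> t \in cheap -> s != t -> beta / 2 <= M I * D (sg s) (sg t).
  move=> sC tC; rewrite -(inj_eq val_inj) neq_ltn => /orP[|] lt; first exact: sep.
  by rewrite d_sym; apply: sep.
have inj : {in cheap &, injective sg}.
  move=> s t sC tC st; apply/eqP; apply: contraT => /(sep2 _ _ sC tC).
  by rewrite st dist_refl mulr0; lra.
have cheap_bound : #|cheap|%:R * (beta / 4) <= M I * graph_cost H.
  rewrite -(card_in_imset inj); apply: (@steiner_cost _ _ _ _ _ (root I)) => //.
  - lra.
  - move=> _ _ /imsetP[s sC ->] /imsetP[t tC ->] st.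
    have /(sep2 _ _ sC tC) : s != t by apply: contraNneq st => ->.
    lra.
  - move=> _ /imsetP[t /cheapP[/andP[bt1 bt2] nt ft] ->].
    have := bid_le_through (sg_F t) (root_open t); lra.
  - by move=> _ /imsetP[t _ ->]; apply: H_joins.
have -> : #|near_scale|%:R = #|cheap|%:R + #|near_scale :\: cheap|%:R :> R.
  rewrite -natrD -(cardsID cheap near_scale); congr (_ + _)%:R.
  by apply: eq_card => t; rewrite in_setI andb_idl // inE => /andP[].
lra.
Qed.

Lemma scale_bound : #|[set t | in_scale t]|%:R * beta <=
  256 * (\sum_(x in Fs) f I x + M I * graph_cost H + \sum_t D (c t) (sg t)).
Proof.
have -> : #|[set t | in_scale t]|%:R =
    #|near_scale|%:R + #|[set t | in_scale t && ~~ near t]|%:R :> R.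
  rewrite -natrD -(cardsID [set t | near t]); congr (_ + _)%:R; apply: eq_card => t.
    by rewrite !inE.
  by rewrite !inE andbC.
have sf : 0 <= \sum_(x in Fs) f I x by apply: sumr_ge0 => x; apply: f_ge0_Fs.
have sd : 0 <= \sum_t D (c t) (sg t) by apply: sumr_ge0 => t _; apply: d_ge0.
have sH : 0 <= M I * graph_cost H by rewrite mulr_ge0 ?M_ge0 ?graph_cost_ge0.
have := far_bound; case: (leP 1 (M I)) => M1.
  by have := near_bound_large_M M1; lra.
by have := near_bound_small_M (ltW M1); lra.
Qed.

(** One option is to open [sg t] and attach it directly to the root; the offline tree connects these
    two points, so it is at least as long as that edge. *)
Lemma bid_le_cost t :
  b t <= \sum_(x in Fs) f I x + M I * graph_cost H + \sum_t D (c t) (sg t).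
Proof.
have := bid_le_through (sg_F t) (root_open t).
have : M I * D (sg t) (root I) <= M I * graph_cost H.
  apply: ler_wpM2l; first exact: M_ge0.
  apply: (dist_le_length (@d_ge0 R I) (@d_sym R I) (@dist_refl R I) (@d_triangle R I)).
  exact: H_joins.
have : f I (sg t) <= \sum_(x in Fs) f I x.
  rewrite (bigD1 (sg t)) //= lerDl sumr_ge0 // => x /andP[xFs _]; exact: f_ge0_Fs.
have : D (c t) (sg t) <= \sum_t D (c t) (sg t).
  by rewrite (bigD1 t) //= lerDl sumr_ge0 // => s _; apply: d_ge0.
lra.
Qed.

End Scale.

(** * Summation of the bids over the dyadic ranges *)

Lemma OPT_solution : exists (Fs : {set V I}) (H : {set {set V I}}) (sg : step -> V I),
  [/\ Fs \subset F I, forall t, sg t \in Fs, forall x, x \in Fs -> connect (adj H) x (root I)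
    & OPT I = \sum_(x in Fs) f I x + M I * graph_cost H + \sum_t D (c t) (sg t)].
Proof.
have [[[Fs H] sg] /and4P[FsF _ /forall_inP Hj /forallP sgF] <-] := OPT_attained I.
exists Fs, H, sg; split=> // x xFs.
have /forall_inP := Hj x (setU1r (root I) xFs); apply; exact: setU11.
Qed.

Lemma OPT_ge0 : 0 <= OPT I.
Proof.
have [Fs [H [sg [FsF sgF _ ->]]]] := OPT_solution; rewrite !addr_ge0 //.
- by apply: sumr_ge0 => x /(subsetP FsF); apply: f_ge0.
- by rewrite mulr_ge0 ?M_ge0 ?graph_cost_ge0.
- by apply: sumr_ge0 => t _; apply: d_ge0.
Qed.

Lemma bid_le_OPT t : b t <= OPT I.
Proof.
by have [Fs [H [sg [FsF sgF Hj ->]]]] := OPT_solution; apply: bid_le_cost.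
Qed.

Lemma sum_scale (beta : R) : 0 < beta ->
  \sum_(t | beta < b t <= 2 * beta) b t <= 512 * OPT I.
Proof.
move=> b0; have [Fs [H [sg [FsF sgF Hj ->]]]] := OPT_solution.
have /= h := scale_bound FsF sgF Hj b0.
apply: le_trans (_ : \sum_(t in [set t | beta < b t <= 2 * beta]) 2 * beta <= _).
  rewrite [leLHS]big_mkcond [leRHS]big_mkcond ler_sum // => t _; rewrite inE.
  by case: ifP => // /andP[].
by rewrite sumr_const -[_ *+ #|_|]mulr_natl; lra.
Qed.

(** No bid exceeds the initial threshold [OPT I]; each halving of the threshold adds one range,
    bounded by [sum_scale]. *)
Lemma sum_large_bids l : 0 < OPT I ->
  \sum_(t | OPT I / 2 ^+ l < b t) b t <= l%:R * (512 * OPT I).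
Proof.
move=> OPT0; elim: l => [|l IHl].
  rewrite mul0r big_pred0 // => t; rewrite expr0 divr1; apply/negbTE.
  by rewrite -leNgt; exact: bid_le_OPT.
have E : OPT I / 2 ^+ l = 2 * (OPT I / 2 ^+ l.+1).
  by rewrite exprS invfM [RHS]mulrCA mulVKf // pnatr_eq0.
have p0 : 0 < OPT I / 2 ^+ l.+1 by rewrite divr_gt0 // exprn_gt0.
rewrite (bigID (fun t => OPT I / 2 ^+ l < b t)) /= -[l.+1%:R]natr1 mulrDl mul1r lerD //.
  apply: le_trans IHl; rewrite [leRHS]big_mkcond [leLHS]big_mkcond ler_sum // => t _.
  have := bid_ge0 t; case: ifP => [/andP[_ ->]//|_]; case: ifP => //.
apply: le_trans (sum_scale p0); rewrite le_eqVlt; apply/orP; left; apply/eqP.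
by apply: eq_bigl => t; rewrite -E -leNgt.
Qed.

Lemma sum_bids l : (k I <= 2 ^ l)%N -> \sum_t b t <= (l%:R * 512 + 1) * OPT I.
Proof.
(* If [OPT I] is 0 there is no positive scale to start from, but all bids are then at most 0. *)
move=> kl; have := OPT_ge0; rewrite le_eqVlt => /predU1P[OPT0|OPT0].
  by rewrite -OPT0 mulr0 sumr_le0 // => t _; rewrite [leRHS]OPT0 bid_le_OPT.
rewrite (bigID (fun t => OPT I / 2 ^+ l < b t)) /= mulrDl mul1r -mulrA.
rewrite lerD // ?sum_large_bids //.
apply: le_trans (_ : \sum_(t : step) OPT I / 2 ^+ l <= _).
  rewrite big_mkcond ler_sum // => t _; case: ifP => [|_]; first by rewrite -leNgt.
  by rewrite divr_ge0 ?ltW // exprn_gt0.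
rewrite sumr_const card_ord -[_ *+ k I]mulr_natl mulrCA ger_pMr //.
by rewrite ler_pdivrMr ?exprn_gt0 // mul1r -natrX ler_nat.
Qed.

Lemma sum_bids_ln : (2 <= k I)%N ->
  \sum_t b t <= 1025 / ln 2 * ln (k I)%:R * OPT I.
Proof.
(* Since [1 <= l], [(l + 1) * 512 + 1 <= 1025 * l]. *)
move=> k2; pose l := trunc_log 2 (k I).
have /andP[kl kl1] : (2 ^ l <= k I < 2 ^ l.+1)%N by apply: trunc_log_bounds; lia.
have l1 : (1 <= l)%N by rewrite trunc_log_gt0.
apply: le_trans (sum_bids (ltnW kl1)) _; rewrite ler_wpM2r ?OPT_ge0 //.
have ln2 : 0 < ln 2 :> R by rewrite ln_gt0 // ltr1n.
have : l%:R * ln 2 <= ln (k I)%:R :> R.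
  rewrite mulr_natl -lnXn // -natrX ler_ln ?posrE ?ltr0n ?expn_gt0 ?ler_nat //; lia.
rewrite mulrAC ler_pdivlMr // => h.
have l1R : 1 <= l%:R :> R by rewrite ler1n.
rewrite -[l.+1%:R]natr1; nra.
Qed.

End OnlineRun.

(** * The algorithm and its runs *)

Section Algorithm.
Variables (R : realType) (n : nat) (M0 : R) (f0 : 'I_n -> R) (rt : 'I_n).

Section Response.
Variable dF : 'I_n -> 'I_n -> R.
(* The facilities opened so far, the bids of the earlier clients with their
   distances to the new client, and the distances from the new client. *)
Variables (opn : seq 'I_n) (past : seq (R * R)) (dc : 'I_n -> R).

Definition opn_or_root x := (x == rt) || (x \in opn).

Definition pair_cost (p : 'I_n * 'I_n) :=
  (if opn_or_root p.1 then 0 else f0 p.1) + M0 * dF p.1 p.2 + dc p.1.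

Definition best_pair := [arg min_(p < (rt, rt) | opn_or_root p.2) pair_cost p]%O.

Definition bid := pair_cost best_pair.

(** The successor counts the new client itself. *)
Definition count_witnesses :=
  (count (fun e : R * R => (bid / 2 <= e.1 <= 2 * bid) && (e.2 <= bid / 8)) past).+1.

Definition pair_triggers (p : 'I_n * 'I_n) := [&& opn_or_root p.2, dc p.1 <= bid / 16
  & f0 p.1 + M0 * dF p.1 p.2 <= 2 * count_witnesses%:R * bid].

Definition respond := (bid, odflt best_pair [pick p | pair_triggers p]).

End Response.

Section History.
Variables (P : Type) (dist : P -> P -> R) (fac : 'I_n -> P).

Definition answer (h : seq (P * (R * ('I_n * 'I_n)))) (p : P) :=
  respond (fun x y => dist (fac x) (fac y)) [seq e.2.2.1 | e <- h]
    [seq (e.2.1, dist e.1 p) | e <- h] (fun x => dist p (fac x)).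

(* Clients, and the answers to them, are listed latest first. *)
Fixpoint history (s : seq P) : seq (P * (R * ('I_n * 'I_n))) :=
  if s is p :: s' then (p, answer (history s') p) :: history s' else [::].

End History.

(** Answers depend on points only through distances, so the computation on the labels of a view can
    be carried over to points. *)
Lemma history_map (P Q : Type) (dist : Q -> Q -> R) (g : P -> Q) (fac : 'I_n -> P) s :
  history dist (g \o fac) (map g s) =
  [seq (g e.1, e.2) | e <- history (fun p q => dist (g p) (g q)) fac s].
Proof. by elim: s => //= p s ->; rewrite /answer -!map_comp. Qed.

End Algorithm.

(** Earlier answers are recomputed from the view. Reopening a facility or buying a loop is harmless,
    since [opened] is a set and [bought_at] drops loops. The default of [head] is not reached once a
    client has arrived. *)
Definition rent_or_open (R : realType) : algorithm R := fun w =>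
  let h := history (v_M w) (@v_cost _ w) (v_root w) (@v_dist _ w) inl
    (rev [seq inr i | i <- enum 'I_(v_narr w)]) in
  let p := head (v_root w, v_root w) [seq e.2.2 | e <- h] in
  MkDecision (Some p.1) [set (inl p.1, inl p.2)] p.1.

(** A union bound, used to charge each facility and each edge to a step that introduces it. *)
Lemma sum_le_cover (R : numDomainType) (T U : finType) (A : {set U})
    (B : T -> {set U}) (w : U -> R) :
  (forall u, u \in A -> exists t, u \in B t) -> (forall t u, u \in B t -> 0 <= w u) ->
  \sum_(u in A) w u <= \sum_t \sum_(u in B t) w u.
Proof.
move=> AB w0; rewrite (exchange_big_dep predT) //= big_mkcond ler_sum // => u _.
have s0 : 0 <= \sum_(t | u \in B t) w u by apply: sumr_ge0 => t; apply: w0.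
case: ifP => // /AB[t ut]; rewrite (bigD1 t) //= lerDl.
by apply: sumr_ge0 => s /andP[/w0].
Qed.

(** * The run of the algorithm on the points of an instance *)

Section Simulation.
Variables (R : realType) (I : instance R).
Notation D := (d I).
Notation c := (client I).
Notation step := 'I_(k I).
Notation fac := 'I_#|F I|.
Notation fac_cost := (fun j : fac => f I (facility j)).
Notation fac_dist := (fun x y : fac => d I (facility x) (facility y)).

(* The value at i >= k I is junk. *)
Definition nth_client (i : nat) : V I := if insub i is Some t then c t else root I.

Definition arrived (t : nat) := rev (map nth_client (iota 0 t)).

Definition root_fac : fac := enum_rank_in (root_F I) (root I).

Definition past (t : nat) :=
  history (M I) fac_cost root_fac D (@facility R I) (arrived t).

Definition reply (t : nat) : R * (fac * fac) :=
  answer (M I) fac_cost root_fac D (@facility R I)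
    (past t) (nth_client t).

Definition chosen (t : step) : V I * V I :=
  (facility (reply t).2.1, facility (reply t).2.2).

Lemma facility_root : facility root_fac = root I.
Proof. exact: enum_rankK_in (root_F I). Qed.

Lemma facilityP v : v \in F I -> exists j : fac, v = facility j.
Proof. by move=> vF; exists (enum_rank_in (root_F I) v); rewrite /facility enum_rankK_in. Qed.

Lemma facility_F (j : fac) : facility j \in F I.
Proof. exact: enum_valP. Qed.

Lemma nth_clientE (t : step) : nth_client t = c t.
Proof. by rewrite /nth_client valK. Qed.

Lemma arrivedS t : arrived t.+1 = nth_client t :: arrived t.
Proof. by rewrite /arrived -addn1 iotaD map_cat rev_cat. Qed.

Lemma pastS t : past t.+1 = (nth_client t, reply t) :: past t.
Proof. by rewrite /past arrivedS. Qed.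

Lemma pastE t : past t = rev [seq (nth_client s, reply s) | s <- iota 0 t].
Proof. by elim: t => // t IHt; rewrite pastS IHt -[t.+1]addn1 iotaD map_cat rev_cat. Qed.

(** The labels of the view at [t] map to the clients [0, ..., t] in order, so [history_map]
    identifies the recomputed history with [past t.+1], whose head is the reply at [t]. *)
Lemma decisionE (t : step) : decision_at (@rent_or_open R) t =
  @MkDecision R (view_at t) (Some (reply t).2.1)
    [set (inl (reply t).2.1, inl (reply t).2.2)] (reply t).2.1.
Proof.
rewrite /decision_at /rent_or_open /=.
set h := history _ _ _ _ _ _.
suff -> : [seq e.2.2 | e <- h] = [seq e.2.2 | e <- past t.+1] by rewrite pastS.
rewrite /past; have -> : arrived t.+1 = map (@point R I t) (rev [seq inr i | i <- enum 'I_t.+1]).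
  rewrite /arrived -val_enum_ord map_rev; congr rev; rewrite -!map_comp.
  apply: eq_map => i /=; have it := leq_trans (ltn_ord i) (ltn_ord t).
  by rewrite /nth_client insubT; congr client; apply: val_inj.
by rewrite (history_map _ _ _ D (@point R I t) inl) -map_comp.
Qed.

Notation opened_facs t := [seq e.2.2.1 | e <- past t].
Notation client_dist t := (fun x : fac => d I (client I t) (facility x)).

Lemma is_openE (t : step) j :
  opn_or_root root_fac (opened_facs t) j = is_open chosen t (facility j).
Proof.
rewrite /opn_or_root /is_open -facility_root (inj_eq enum_val_inj); congr (_ || _).
rewrite pastE map_rev mem_rev -map_comp.
apply/mapP/existsP => /= [[s]|[s /andP[st /eqP/enum_val_inj <-]]].
  rewrite mem_iota /= add0n => st ->.
  by exists (Ordinal (ltn_trans st (ltn_ord t))); rewrite /chosen /= st eqxx.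
by exists (val s); rewrite // mem_iota.
Qed.

Let replyE (t : step) : reply t = answer (M I) fac_cost
  root_fac D (@facility R I) (past t) (c t).
Proof. by rewrite /reply nth_clientE. Qed.

Definition bid_at (t : step) : R := (reply t).1.

Lemma option_costE (t : step) p :
  pair_cost (M I) fac_cost root_fac
    fac_dist (opened_facs t)
    (client_dist t) p =
  option_cost chosen t (facility p.1, facility p.2).
Proof. by rewrite /pair_cost is_openE. Qed.

Lemma eligibleE (t : step) p : eligible chosen t (facility p.1, facility p.2) =
  opn_or_root root_fac (opened_facs t) p.2.
Proof. by rewrite /eligible /= facility_F is_openE. Qed.

Lemma open_facility (t : step) v : is_open chosen t v -> exists j : fac, v = facility j.
Proof.
case/predU1P => [->|/existsP[s /andP[_ /eqP<-]]]; last by exists (reply s).2.1.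
exact/facilityP/root_F.
Qed.

Lemma eligible_facilities (t : step) p : eligible chosen t p ->
  exists q : fac * fac, p = (facility q.1, facility q.2).
Proof.
by case: p => x y /andP[/= /facilityP[i ->] /open_facility[j ->]]; exists (i, j).
Qed.

Lemma best_pairP (t : step) : exists p,
  [/\ best_pair (M I) fac_cost root_fac
    fac_dist (opened_facs t)
    (client_dist t) = p,
    eligible chosen t (facility p.1, facility p.2),
    bid_at t = option_cost chosen t (facility p.1, facility p.2)
    & forall q, eligible chosen t q -> bid_at t <= option_cost chosen t q].
Proof.
rewrite /bid_at replyE /= /bid option_costE.
have r0 : opn_or_root root_fac (opened_facs t) (root_fac, root_fac).2.
  by rewrite /opn_or_root eqxx.
rewrite /best_pair; case: arg_minP => // p op minp.
exists p; split=> //; first by rewrite eligibleE.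
move=> q eq; have [p' qE] := eligible_facilities eq.
by move: eq; rewrite qE -!option_costE eligibleE => /minp.
Qed.

Lemma chosen_eligible (t : step) : eligible chosen t (chosen t).
Proof.
have [p [pE pel _ _]] := best_pairP t.
rewrite /chosen replyE /= pE.
case: pickP => [q /and3P[oq _ _]|_] //=; by rewrite eligibleE.
Qed.

Lemma bid_at_le (t : step) p : eligible chosen t p -> bid_at t <= option_cost chosen t p.
Proof. by have [_ [_ _ _]] := best_pairP t; apply. Qed.

Lemma bid_at_attained (t : step) :
  exists2 p, eligible chosen t p & bid_at t = option_cost chosen t p.
Proof. by have [p [_ ? ? _]] := best_pairP t; exists (facility p.1, facility p.2). Qed.

Lemma count_witnessesE (t : step) :
  count_witnesses (M I) fac_cost root_fac
    fac_dist (opened_facs t)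
    [seq (e.2.1, D e.1 (c t)) | e <- past t] (client_dist t)
  = #|witnesses bid_at t|.
Proof.
have tW := self_witness bid_at_attained t.
rewrite (cardsD1 t) tW add1n; congr _.+1.
have -> : bid (M I) fac_cost root_fac
    fac_dist (opened_facs t)
    (client_dist t) = bid_at t by rewrite /bid_at replyE.
pose Q s := (bid_at t / 2 <= (reply s).1 <= 2 * bid_at t)
  && (D (nth_client s) (c t) <= bid_at t / 8).
transitivity (\sum_(s < t | Q s) 1)%N.
  rewrite count_map pastE count_rev count_map -sum1_count.
  have -> : iota 0 t = index_iota 0 t by rewrite /index_iota subn0.
  by rewrite big_mkord.
rewrite (big_ord_widen_cond _ Q (fun=> 1%N) (ltnW (ltn_ord t))) -[RHS]sum1_card.
apply: eq_bigl => s; rewrite !inE /Q nth_clientE -/(bid_at s) ltn_neqAle.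
by rewrite (inj_eq val_inj) andbC -andbA.
Qed.

Lemma chosen_rule (t : step) : triggers bid_at chosen t (chosen t) \/
  option_cost chosen t (chosen t) = bid_at t /\ forall p, ~~ triggers bid_at chosen t p.
Proof.
have trigE q : triggers bid_at chosen t (facility q.1, facility q.2) =
    pair_triggers (M I) fac_cost root_fac
      fac_dist (opened_facs t)
      [seq (e.2.1, D e.1 (c t)) | e <- past t] (client_dist t) q.
  by rewrite /triggers /pair_triggers eligibleE count_witnessesE /bid_at replyE.
have [p [pE _ bE _]] := best_pairP t.
have chE : chosen t = let q := odflt p [pick q | triggers bid_at chosen t (facility q.1, facility q.2)] in
    (facility q.1, facility q.2).
  by rewrite /chosen replyE /= pE; under [in RHS]eq_pick do rewrite trigE.
move: chE; case: pickP => /= [q tq ->|nq ->]; first by left.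
right; split=> // q; apply/negP => tq.
have [q' qE] := eligible_facilities (proj1 (andP tq)).
by have := nq q'; rewrite /= -qE tq.
Qed.

Lemma openedP m x : reflect (exists2 s : step, (s < m)%N & x = (chosen s).1)
  (x \in opened (@rent_or_open R) I m).
Proof.
rewrite inE; apply: (iffP existsP) => [[s /andP[sm]]|[s sm ->]].
  by rewrite decisionE => /eqP[<-]; exists s.
by exists s; rewrite sm decisionE /=.
Qed.

Lemma bought_atE (t : step) : bought_at (@rent_or_open R) t =
  if (chosen t).1 == (chosen t).2 then set0 else [set [set (chosen t).1; (chosen t).2]].
Proof.
apply/setP => e; rewrite /bought_at decisionE.
apply/imsetP/idP => [[q]|].
  by rewrite inE /= inE => /andP[/eqP-> /negbTE/= ne] ->; rewrite ne inE.
case: eqP => [|/eqP ne]; rewrite inE // => /eqP->.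
exists (inl (reply t).2.1, inl (reply t).2.2) => //=; rewrite inE /=.
by rewrite set11.
Qed.

Lemma adj_sym (T : finType) (H : {set {set T}}) : symmetric (adj H).
Proof. by move=> x y; rewrite /adj setUC. Qed.

Lemma boughtP m e : reflect
  (exists2 s : step, (s < m)%N /\ (chosen s).1 != (chosen s).2 & e = [set (chosen s).1; (chosen s).2])
  (e \in bought (@rent_or_open R) I m).
Proof.
apply: (iffP bigcupP) => [[s sm]|[s [sm ne] ->]].
  by rewrite bought_atE; case: eqVneq => ne; rewrite inE // => /eqP->; exists s.
by exists s => //; rewrite bought_atE (negbTE ne) inE.
Qed.

(** Strong induction on [s]: the second point is the root or was opened earlier, and the bought edge
    joins the first point to it unless they coincide. *)
Lemma chosen_connected m (s : step) : (s < m)%N ->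
  connect (adj (bought (@rent_or_open R) I m)) (chosen s).1 (root I) &&
  connect (adj (bought (@rent_or_open R) I m)) (chosen s).2 (root I).
Proof.
have [n] := ubnP (s : nat); elim: n s => // n IHs s; rewrite ltnS => sn sm.
set H := bought _ _ _ in IHs *.
have conn2 : connect (adj H) (chosen s).2 (root I).
  have /andP[_ /predU1P[->|/existsP[s' /andP[s's /eqP<-]]]] := chosen_eligible s.
    exact: connect0.
  by have /andP[] := IHs s' (leq_trans s's sn) (ltn_trans s's sm).
rewrite conn2 andbT; apply: connect_trans conn2.
have [->|ne] := eqVneq (chosen s).1 (chosen s).2; first exact: connect0.
by apply/connect1/boughtP; exists s.
Qed.

Lemma rent_or_open_feasible : run_feasible (@rent_or_open R) I.
Proof.
move=> t; split; last by apply/openedP; exists t; rewrite // /assigned decisionE.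
apply/andP; split.
  by apply/forall_inP => e /boughtP[s [_ ne] ->]; rewrite cards2 ne.
set H := bought _ _ _.
have to_root x : x \in root I |: opened (@rent_or_open R) I t.+1 :|: cover H ->
    connect (adj H) x (root I).
  rewrite !inE -orbA => /or3P[/eqP->|xo|]; first exact: connect0.
    have /openedP[s st ->] : x \in opened (@rent_or_open R) I t.+1 by rewrite inE.
    by have /andP[] := chosen_connected st.
  case/bigcupP => e /boughtP[s [st _] ->].
  by have /andP[? ?] := chosen_connected st; rewrite !inE => /orP[] /eqP->.
apply/forall_inP => x xS; apply/forall_inP => y yS.
apply: connect_trans (to_root x xS) _; rewrite sym_connect_sym; [exact: to_root|exact: adj_sym].
Qed.

Lemma run_cost_le : run_cost (@rent_or_open R) I <= \sum_t option_cost chosen t (chosen t).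
Proof.
rewrite /run_cost /run /= /option_cost !big_split /= !lerD //.
(* The root is open from the start at cost 0, so it is set aside. *)
- rewrite (bigID (pred1 (root I))) /= big1 ?add0r => [|x /andP[_ /eqP->]]; last exact: f_root.
  pose B t := if is_open chosen t (chosen t).1 then set0 else [set (chosen t).1].
  apply: le_trans (_ : \sum_(x in opened (@rent_or_open R) I (k I) :\ root I) f I x <= _).
    by rewrite le_eqVlt; apply/orP; left; apply/eqP/eq_bigl => x; rewrite in_setD1 andbC.
  apply: le_trans (sum_le_cover (B := B) _ _) _ => [x||].
  + case/setD1P => xr /openedP[s sk xs].
    (* The cost of [x] is charged to the first step choosing it, when [x] is not yet open. *)
    have ex : exists n, (n < k I)%N && [exists t : step, (t == n :> nat) && (x == (chosen t).1)].
      by exists s; rewrite sk; apply/existsP; exists s; rewrite eqxx xs eqxx.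
    case: (ex_minnP ex) => n /andP[nk /existsP[t /andP[/eqP tn /eqP xt]]] minn.
    exists t; rewrite /B -xt; case: ifP => [|_]; last by rewrite inE.
    case/predU1P => [xr'|/existsP[t' /andP[t't /eqP x't]]]; first by rewrite xr' eqxx in xr.
    have /minn : (t' < k I)%N && [exists t : step, (t == t' :> nat) && (x == (chosen t).1)].
      by rewrite ltn_ord; apply/existsP; exists t'; rewrite eqxx x't eqxx.
    by rewrite -tn leqNgt t't.
  + move=> t x; rewrite /B; case: ifP => _; rewrite inE // => /eqP->.
    by apply: f_ge0; have /andP[] := chosen_eligible t.
  + apply: ler_sum => t _; rewrite /B.
    by case: ifP => _; rewrite ?big_set0 ?big_set1.
- rewrite -mulr_sumr ler_wpM2l ?M_ge0 //.
  apply: le_trans (sum_le_cover (B := bought_at (@rent_or_open R) (I := I)) _ _) _.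
  + by move=> e /bigcupP[t _ et]; exists t.
  + by move=> t e _; apply: set_length_ge0; apply: d_ge0.
  apply: ler_sum => t _; rewrite bought_atE; case: eqP => _.
    by rewrite big_set0 d_ge0.
  by rewrite big_set1 edge_lengthE.
- by apply: ler_sum => t _; rewrite ffunE /assigned decisionE.
Qed.

End Simulation.

Theorem theorem1p3 (R : realType) :
  exists A : algorithm R, online_algorithm A /\ log_competitive A.
Proof.
exists (@rent_or_open R); split; first exact: rent_or_open_feasible.
exists (6 * (1025 / ln 2)) => I k2.
apply: le_trans (run_cost_le I) _.
apply: le_trans (sum_option_cost (@chosen_eligible _ I) (@bid_at_le _ I)
  (@bid_at_attained _ I) (@chosen_rule _ I)) _.
rewrite -!mulrA ler_pM2l // !mulrA.
exact: sum_bids_ln (@chosen_eligible _ I) (@bid_at_le _ I) (@bid_at_attained _ I)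
  (@chosen_rule _ I) k2.
Qed.
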